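(* Let $H$ be a separable complex Hilbert space, let $A\in\mathcal{B}(H)$ and let $N(\cdot)$ be a norm on $\mathcal{B}(H)$. Then $$w_N(A)\le \sup_{\theta\in\mathbb{R}}\int_0^1 N\big((1-\lambda)e^{i\theta}A+\lambda e^{-i\theta}A^*\big)\,d\lambda\le \frac12 w_N(A)+\frac14\big(N(A)+N(A^* )\big)\le \frac12\big(N(A)+N(A^* )\big).$$
   Context: $\mathcal{B}(H)$ is the space of bounded linear operators on $H$. For $T\in\mathcal{B}(H)$, $Re(T)=\frac{T+T^*}{2}$. For a norm $N(\cdot)$ on $\mathcal{B}(H)$ (an arbitrary norm on this complex vector space), the generalized numerical radius is $w_N(A)=\sup_{\theta\in\mathbb{R}}N(Re(e^{i\theta}A))$. *)

(* Defs.v *)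
From HB Require Import structures.
From mathcomp Require Import all_boot all_order all_algebra.
From mathcomp Require Import complex.
From mathcomp Require Import all_classical all_reals all_analysis.

Set Implicit Arguments.
Unset Strict Implicit.
Unset Printing Implicit Defensive.

Import Order.TTheory GRing.Theory Num.Theory.
Import numFieldNormedType.Exports.

Local Open Scope classical_set_scope.
Local Open Scope complex_scope.
Local Open Scope ring_scope.

(* The inner product is linear in the first argument and conjugate-linear in
   the second, as in the library's Hermitian forms. *)
HB.mixin Record CompleteNormedModule_isHilbert (R : realType) H
    & CompleteNormedModule R[i] H := {
  hdot : {dot H for Num.conj} ;
  hdot_normE : forall x : H, `|x| ^+ 2 = hdot x x
}.

#[short(type="hilbertType")]
HB.structure Definition Hilbert (R : realType) :=
  {H of CompleteNormedModule_isHilbert R H & CompleteNormedModule R[i] H}.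

Definition separable (T : topologicalType) :=
  exists2 D : set T, countable D & dense D.

Section BoundedOperators.
Context {R : realType} {H : hilbertType R}.

Definition bounded_linear (f : H -> H) :=
  linear f /\ exists M : R, forall x : H, `|f x| <= M%:C * `|x|.

Definition bounded_linear_pred : {pred H -> H} :=
  fun f => `[< bounded_linear f >].

Lemma bounded_linear_submod_closed : submod_closed bounded_linear_pred.
Proof.
split=> [|a f g /asboolP[fl [M fM]] /asboolP[gl [K gK]]]; apply/asboolP.
  split=> [k x y|]; first by rewrite /= scaler0 addr0.
  by exists 0 => x; rewrite mul0r normr0.
split=> [k x y|].
  rewrite -[LHS]/(a *: f (k *: x + y) + g (k *: x + y)).
  rewrite -[RHS]/(k *: (a *: f x + g x) + (a *: f y + g y)).
  by rewrite fl gl !scalerDr !scalerA (mulrC a k) addrACA.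
exists (Normc.normc a * M + K) => x.
rewrite -[X in `|X|]/(a *: f x + g x) (le_trans (ler_normD _ _))//.
by rewrite rmorphD rmorphM/= mulrDl lerD// normrZ -mulrA ler_wpM2l.
Qed.

HB.instance Definition _ :=
  GRing.isSubmodClosed.Build _ _ bounded_linear_pred
    bounded_linear_submod_closed.

End BoundedOperators.

Record bop (R : realType) (H : hilbertType R) := Bop {
  bop_fun :> H -> H ;
  bop_funP : bop_fun \in bounded_linear_pred
}.

Section BopTheory.
Context {R : realType} {H : hilbertType R}.

HB.instance Definition _ := [isSub for @bop_fun R H].
HB.instance Definition _ := [Choice of bop H by <:].
HB.instance Definition _ := [SubChoice_isSubLmodule of bop H by <:].

(* The adjoint of T is the operator S with <T x, y> = <x, S y>, which exists
   and is unique by the Riesz representation theorem; the default value 0 of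
   xget is never used. *)
Definition adjoint (T : bop H) : bop H :=
  xget 0 [set S : bop H | forall x y : H, hdot (T x) y = hdot x (S y)].

Definition re_op (T : bop H) : bop H := 2^-1 *: (T + adjoint T).

(* e ^ (i t) *)
Definition expi (t : R) : R[i] := cos t +i* sin t.

(* Norms on the complex vector space B(H); Normc.normc is the real-valued
   modulus on R[i]. *)
Record is_norm (N : bop H -> R) : Prop := IsNorm {
  is_norm_ge0 : forall T, 0 <= N T ;
  is_norm_eq0 : forall T, N T = 0 -> T = 0 ;
  is_normZ : forall (c : R[i]) T, N (c *: T) = Normc.normc c * N T ;
  is_normD : forall S T, N (S + T) <= N S + N T
}.

Definition num_radius (N : bop H -> R) (A : bop H) : \bar R :=
  ereal_sup (range (fun t : R => (N (re_op (expi t *: A)))%:E)).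

End BopTheory.

(* Main.v *)
Require Import Defs.
From HB Require Import structures.
From mathcomp Require Import all_boot all_order all_algebra.
From mathcomp Require Import complex.
From mathcomp Require Import all_classical all_reals all_analysis.
From mathcomp Require Import unstable measurable_realfun ring lra.

Import Order.TTheory GRing.Theory Num.Theory.
Import numFieldNormedType.Exports.

Local Open Scope classical_set_scope.
Local Open Scope complex_scope.
Local Open Scope ring_scope.

(* Put X = e^{it} A and Y = e^{-it} A^*, so that Y is the adjoint of X, and let
   f l = N ((1 - l) X + l Y). This function is convex and Lipschitz, with
   f 0 = N A, f 1 = N A^* and f (1/2) = N (Re (e^{it} A)). The Hermite-Hadamard
   inequality f (1/2) <= \int_0^1 f <= f (1/2) / 2 + (f 0 + f 1) / 4 gives the
   first two bounds on taking suprema over t, and f (1/2) <= (f 0 + f 1) / 2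
   gives the last one. *)

(** Testing with [x = u - v] gives [|u - v| ^ 2 = 0]. This makes adjoints unique. *)
Lemma hdot_inj {R : realType} {H : hilbertType R} (u v : H) :
  (forall x, hdot x u = hdot x v) -> u = v.
Proof.
move=> uv; apply/eqP; rewrite -subr_eq0 -normr_eq0 -[_ == 0]sqrf_eq0.
by rewrite hdot_normE linearBr subr_eq0; apply/eqP; exact: uv.
Qed.

Lemma adjoint_uniq {R : realType} {H : hilbertType R} {T S : bop H} :
  (forall x y, hdot (T x) y = hdot x (S y)) -> adjoint T = S.
Proof.
move=> TS; apply: xget_unique => //= S' TS'.
apply/val_inj/funext => y; apply: hdot_inj => x.
by rewrite -[LHS]TS' TS.
Qed.

(* No appeal to the Riesz theorem: for c != 0, T has an adjoint iff c *: T has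
   one, and if neither does both sides are the default value 0. *)
Lemma adjointZ {R : realType} {H : hilbertType R} (c : R[i]) (T : bop H) :
  c != 0 -> adjoint (c *: T) = Num.conj c *: adjoint T.
Proof.
move=> c0.
have scal (k : R[i]) (T' S : bop H) :
    (forall x y, hdot (T' x) y = hdot x (S y)) ->
  forall x y, hdot ((k *: T') x) y = hdot x ((Num.conj k *: S) y).
  move=> TS x y.
  rewrite -[(k *: T') x]/(k *: T' x) -[(_ *: S) y]/(_ *: S y).
  by rewrite linearZl_LR linearZr_LR /= conjCK TS.
have [[S TS]|noS] := pselect
    (exists S : bop H, forall x y, hdot (T x) y = hdot x (S y)).
  by rewrite (adjoint_uniq TS) (adjoint_uniq (scal _ _ _ TS)).
rewrite {2}/adjoint xgetPN; last by move=> S TS; apply: noS; exists S.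
rewrite scaler0 /adjoint xgetPN// => S /(scal c^-1).
by rewrite scalerA mulVf// scale1r => TS; apply: noS; eexists; exact: TS.
Qed.

Lemma integral_affine {R : realType} (u v : R) :
  (\int[lebesgue_measure]_(x in `[0%R, 2^-1%R]) (u + v * x)%:E)%E
  = (2^-1 * u + 8^-1 * v)%:E.
Proof.
pose F (x : R) : R := u * x + v * (2^-1 * x ^+ 2).
have dF (x : R) : is_derive x 1 F (u + v * x).
  by apply: is_derive_eq; rewrite /GRing.scale/=; field.
rewrite (@continuous_FTC2 _ _ F)//.
- by rewrite -EFinB /F; congr EFin; field.
- apply: continuous_subspaceT => x.
  by apply: cvgD; [exact: cvg_cst|apply: cvgM; [exact: cvg_cst|exact: cvg_id]].
- have cF x : {for x, continuous F}.
    by apply/differentiable_continuous/derivable1_diffP.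
  split=> [x _||]; first by [].
  + by apply: cvg_at_right_filter; exact: cF.
  + by apply: cvg_at_left_filter; exact: cF.
- by move=> x _; rewrite derive1E derive_val.
Qed.

Lemma continuous_measurable_EFin {R : realType} (f : R -> R) (D : set R) :
  continuous f -> measurable_fun D (fun x => (f x)%:E).
Proof.
move=> cf; apply/measurable_EFinP/measurable_funTS.
exact: continuous_measurable_fun.
Qed.

(** The reflection [x -> 1 - x] carries [[1/2, 1]] onto [[0, 1/2]]. After folding, both
    Hermite-Hadamard bounds hold pointwise under the integral. *)
Lemma integral01_fold {R : realType} (f : R -> R) :
    continuous f -> (forall x, 0 <= f x) ->
  (\int[lebesgue_measure]_(x in `[0%R, 1%R]) (f x)%:E
   = \int[lebesgue_measure]_(x in `[0%R, 2^-1%R]) (f x + f (1 - x))%:E)%E.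
Proof.
move=> cf f0.
have cf1 : continuous (f \o onem).
  move=> x; apply: continuous_comp; last exact: cf.
  by apply: cvgB; [exact: cvg_cst|exact: cvg_id].
(* The pieces are [[0, 1/2[] and [[1/2, 1]], which are disjoint; the first is closed up again later,
   at no cost to the integral. *)
rewrite (@itv_bndbnd_setU _ _ (BLeft 0) (BLeft 2^-1))//; last 2 first.
- by rewrite bnd_simp; lra.
- by rewrite bnd_simp; lra.
rewrite ge0_integral_setU//=; last 3 first.
- exact: continuous_measurable_EFin.
- by move=> x _; rewrite lee_fin.
- rewrite disj_set2E; apply/eqP/seteqP; split=> // x [] /=.
  by rewrite !in_itv /= => /andP[_ +] /andP[+ _]; lra.
rewrite integral_itv_bndo_bndc; last exact: continuous_measurable_EFin.
(* Substituting in [f \o onem] rather than in [f] makes the two reflections cancel on [[1/2, 1]]. *)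
have := @integration_by_substitution_onem R (f \o onem) 2^-1.
have -> : (2^-1 : R).~ = 2^-1 by rewrite /onem; lra.
under [in X in _ -> _ -> _ = X]eq_integral do rewrite /= onemK.
move=> <-; last 2 first.
- by lra.
- exact: continuous_subspaceT.
rewrite -ge0_integralD//=.
- by move=> x _; rewrite lee_fin.
- exact: continuous_measurable_EFin.
- by move=> x _; rewrite lee_fin.
- exact: continuous_measurable_EFin.
Qed.

Lemma hermite_hadamard01 {R : realType} (f : R -> R) :
    continuous f -> (forall x, 0 <= f x) ->
    (forall l x y, 0 <= l <= 1 ->
       f ((1 - l) * x + l * y) <= (1 - l) * f x + l * f y) ->
  ((f 2^-1)%:E <= \int[lebesgue_measure]_(x in `[0%R, 1%R]) (f x)%:E
     <= (2^-1 * f 2^-1 + 4^-1 * (f 0 + f 1))%:E)%E.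
Proof.
move=> cf f0 convf; rewrite integral01_fold//.
have ca (u v : R) : continuous (fun x : R => u + v * x).
  move=> x; apply: cvgD; first exact: cvg_cst.
  by apply: cvgM; [exact: cvg_cst|exact: cvg_id].
have cs : continuous (fun x : R => f x + f (1 - x)).
  move=> x; apply: cvgD; first exact: cf.
  apply: (@cvg_comp _ _ _ (fun y => 1 - y) f _ (nbhs (1 - x))); last exact: cf.
  by apply: cvgB; [exact: cvg_cst|exact: cvg_id].
apply/andP; split.
  have -> : (f 2^-1)%:E = (\int[lebesgue_measure]_(x in `[0%R, 2^-1%R])
      (2 * f 2^-1 + 0 * x)%:E)%E.
    by rewrite integral_affine; congr EFin; field.
  apply: ge0_le_integral => //.
  - by move=> x _; rewrite lee_fin mul0r addr0 mulr_ge0.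
  - exact: continuous_measurable_EFin.
  - exact: continuous_measurable_EFin.
  - move=> x _; rewrite lee_fin.
    (* [1/2] is the midpoint of [x] and [1 - x], so [2 * f (1/2) <= f x + f (1 - x)]. *)
    have := convf 2^-1 x (1 - x).
    have -> : (1 - 2^-1) * x + 2^-1 * (1 - x) = 2^-1 :> R by field.
    lra.
(* The affine integrand is the sum of two chords of [f], evaluated at [x] and at [1 - x]: the one
   over [[0, 1/2]] and the one over [[1/2, 1]]. *)
have -> : (2^-1 * f 2^-1 + 4^-1 * (f 0 + f 1))%:E =
    (\int[lebesgue_measure]_(x in `[0%R, 2^-1%R])
      ((f 0 + f 1) + (4 * f 2^-1 - 2 * (f 0 + f 1)) * x)%:E)%E.
  by rewrite integral_affine; congr EFin; field.
apply: ge0_le_integral => //.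
- by move=> x _; rewrite lee_fin addr_ge0.
- exact: continuous_measurable_EFin.
- exact: continuous_measurable_EFin.
- move=> x /=; rewrite in_itv /= => /andP[x0 x1]; rewrite lee_fin.
  (* [x] lies at the fraction [2 * x] of the way from [0] to [1/2], and [1 - x] at the same fraction
     of the way from [1] to [1/2]. *)
  have := convf (2 * x) 0 2^-1; have := convf (2 * x) 1 2^-1.
  have -> : (1 - 2 * x) * 0 + 2 * x * 2^-1 = x :> R by field.
  have -> : (1 - 2 * x) * 1 + 2 * x * 2^-1 = 1 - x :> R by field.
  have -> : 0 <= 2 * x <= 1 by lra.
  by move=> /(_ isT) h1 /(_ isT) h2; lra.
Qed.

Lemma normcC {R : realType} (r : R) : Normc.normc r%:C = `|r|.
Proof. by rewrite /= expr0n addr0 sqrtr_sqr. Qed.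

Lemma expi_neq0 {R : realType} (t : R) : expi t != 0.
Proof.
apply/eqP => -[c0 s0]; have := cos2Dsin2 t.
by rewrite c0 s0 expr0n addr0 => /eqP; rewrite eq_sym oner_eq0.
Qed.

Lemma conj_expi {R : realType} (t : R) : Num.conj (expi t) = expi (- t).
Proof. by rewrite /expi cosN sinN. Qed.

Section OperatorNorm.
Context {R : realType} {H : hilbertType R} (N : bop H -> R) (HN : is_norm N).

Definition norm_segment (X Y : bop H) (x : R) : R :=
  N ((1 - x)%:C *: X + x%:C *: Y).

Lemma is_norm_expi (t : R) (T : bop H) : N (expi t *: T) = N T.
Proof. by rewrite is_normZ// /Normc.normc /= cos2Dsin2 sqrtr1 mul1r. Qed.

Lemma norm_segment_convex (X Y : bop H) (l x y : R) : 0 <= l <= 1 ->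
  norm_segment X Y ((1 - l) * x + l * y) <=
  (1 - l) * norm_segment X Y x + l * norm_segment X Y y.
Proof.
move=> /andP[l0 l1].
have NZ (r : R) T : 0 <= r -> r * N T = N (r%:C *: T).
  by move=> r0; rewrite is_normZ// normcC ger0_norm.
rewrite /norm_segment !NZ ?subr_ge0//; apply: le_trans (is_normD HN _ _).
rewrite !scalerDr !scalerA addrACA -!scalerDl -!rmorphM -!rmorphD /=.
(* What remains is an equality: [N] is applied to the same operator on both sides, the segment being
   affine in its parameter. *)
rewrite le_eqVlt; apply/predU1l/congr1.
by congr (_%:C *: _ + _%:C *: _); ring.
Qed.

Lemma norm_segment_midpoint (X Y : bop H) :
  norm_segment X Y 2^-1 <=
  2^-1 * (norm_segment X Y 0 + norm_segment X Y 1).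
Proof.
have := norm_segment_convex X Y 2^-1 0 1.
rewrite mulr0 mulr1 add0r.
have -> : 0 <= 2^-1 :> R by lra.
have -> : 2^-1 <= 1 :> R by lra.
by move=> /(_ isT); lra.
Qed.

(** Two points of the segment differ by [(x - y) *: (Y - X)], so the triangle inequality suffices.
    Continuity thus comes from the norm axioms alone, whatever the relation of [N] to the topology
    of [H]. *)
Lemma norm_segment_lipschitz (X Y : bop H) (x y : R) :
  `|norm_segment X Y x - norm_segment X Y y| <= `|x - y| * N (Y - X).
Proof.
have lip (a b : R) :
    norm_segment X Y a - norm_segment X Y b <= `|a - b| * N (Y - X).
  rewrite /norm_segment -normcC -is_normZ// lerBlDr.
  apply: le_trans (is_normD HN _ _).
  rewrite le_eqVlt; apply/predU1l/congr1.
  rewrite scalerBr (addrC (_ *: Y)) -scaleNr addrACA -!scalerDl.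
  by rewrite -rmorphN -!rmorphD /=; congr (_%:C *: _ + _%:C *: _); ring.
by rewrite ler_norml lip andbT lerNl opprB distrC lip.
Qed.

Lemma norm_segment_continuous (X Y : bop H) : continuous (norm_segment X Y).
Proof.
move=> x; apply/cvgrPdist_le => e e0.
(* The [+ 1] keeps the divisor positive when [X = Y]. *)
have c0 : 0 < N (Y - X) + 1 by rewrite ltr_wpDl// is_norm_ge0.
have : \forall y \near x, `|x - y| <= e / (N (Y - X) + 1).
  by have /cvgrPdist_le := @cvg_id _ (nbhs x); apply; rewrite divr_gt0.
apply: filterS => y; rewrite ler_pdivlMr// mulrDr mulr1 => xy.
apply: le_trans (norm_segment_lipschitz _ _ _ _) _.
by apply: le_trans xy; rewrite lerDl.
Qed.

End OperatorNorm.

Theorem theorem4p3 (R : realType) (H : hilbertType R) (Hsep : separable H)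
    (A : bop H) (N : bop H -> R) (HN : is_norm N) :
  let I : \bar R := ereal_sup (range (fun t : R =>
    (\int[lebesgue_measure]_(l in `[0%R, 1%R])
      (N (((1 - l)%:C * expi t) *: A
          + (l%:C * expi (- t)) *: adjoint A))%:E)%E)) in
  [/\ (num_radius N A <= I)%E,
      (I <= (2^-1)%:E * num_radius N A
              + (4^-1 * (N A + N (adjoint A)))%:E)%E
    & ((2^-1)%:E * num_radius N A + (4^-1 * (N A + N (adjoint A)))%:E
        <= (2^-1 * (N A + N (adjoint A)))%:E)%E].
Proof.
move=> I.
pose X t := expi t *: A; pose Y t := expi (- t) *: adjoint A.
have IE t : (\int[lebesgue_measure]_(l in `[0%R, 1%R])
      (N (((1 - l)%:C * expi t) *: A
          + (l%:C * expi (- t)) *: adjoint A))%:E)%E =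
    (\int[lebesgue_measure]_(l in `[0%R, 1%R])
      (norm_segment N (X t) (Y t) l)%:E)%E.
  by apply: eq_integral => l _; rewrite /norm_segment /X /Y !scalerA.
have NX t : norm_segment N (X t) (Y t) 0 = N A.
  by rewrite /norm_segment subr0 scale1r scale0r addr0 is_norm_expi.
have NY t : norm_segment N (X t) (Y t) 1 = N (adjoint A).
  by rewrite /norm_segment subrr scale1r scale0r add0r is_norm_expi.
have Nre t : norm_segment N (X t) (Y t) 2^-1 = N (re_op (expi t *: A)).
  rewrite /norm_segment /re_op adjointZ ?expi_neq0// conj_expi scalerDr.
  have -> : 1 - 2^-1 = 2^-1 :> R by field.
  by rewrite fmorphV rmorph_nat.
have HH t := hermite_hadamard01 _ (norm_segment_continuous _ HN (X t) (Y t))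
  (fun=> is_norm_ge0 HN _) (norm_segment_convex _ HN (X t) (Y t)).
split.
- apply: ge_ereal_sup => _ [t _ <-].
  apply: le_ereal_sup_tmp; exists (\int[lebesgue_measure]_(l in `[0%R, 1%R])
      (norm_segment N (X t) (Y t) l)%:E)%E; first by exists t.
  by rewrite -Nre; case/andP: (HH t).
- apply: ge_ereal_sup => _ [t _ <-]; rewrite IE.
  have /andP[_ /le_trans] := HH t; apply.
  (* The endpoint values do not depend on [t], so only the midpoint term has to be bounded by the
     supremum. *)
  rewrite NX NY Nre EFinD leeD2r// EFinM lee_wpmul2l ?lee_fin//.
  by apply: ereal_sup_ubound; exists t.
(* With [s = N A + N (adjoint A)], midpoint convexity bounds the radius by [s / 2]; half of that
   plus [s / 4] is [s / 2]. *)
- have le_radius : (num_radius N A <= (2^-1 * (N A + N (adjoint A)))%:E)%E.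
    apply: ge_ereal_sup => _ [t _ <-]; rewrite lee_fin -Nre.
    by rewrite -(NX t) -(NY t) norm_segment_midpoint.
  apply: (@le_trans _ _ ((2^-1)%:E * (2^-1 * (N A + N (adjoint A)))%:E
      + (4^-1 * (N A + N (adjoint A)))%:E)%E).
    by rewrite leeD2r// lee_wpmul2l// lee_fin.
  rewrite -EFinM -EFinD lee_fin; move: (N A + _) => s; clear; lra.
Qed.
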